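(* Let $E$ be a real Hilbert space, $s\subseteq E$ a convex set, and $f:E\to\mathbb{R}$ a function that has a gradient $\nabla f(x)$ at every point $x\in s$. The following statements are equivalent: (1) $f$ is convex on $s$. (2) For all $x,y\in s$, $f(y)\ge f(x)+\langle\nabla f(x),y-x\rangle$. (3) For all $x,y\in s$, $\langle\nabla f(x)-\nabla f(y),x-y\rangle\ge0$.
   Context: $f:E\to\mathbb{R}$ has gradient $\nabla f(x)\in E$ at $x$ if $\lim_{\|h\|\to0}\frac{f(x+h)-f(x)-\langle\nabla f(x),h\rangle}{\|h\|}=0$. *)

(* Defs.v *)
From HB Require Import structures.
From mathcomp Require Import all_boot all_order all_algebra.
From mathcomp Require Import all_classical all_reals all_analysis.
Import Order.TTheory GRing.Theory Num.Theory.
Import numFieldNormedType.Exports.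

Set Implicit Arguments.
Unset Strict Implicit.
Unset Printing Implicit Defensive.

Local Open Scope classical_set_scope.
Local Open Scope ring_scope.

(* A real Hilbert space is a complete normed space [E] together with an inner
   product [ip] that induces its norm. *)
Definition induces_norm (R : realType) (E : normedModType R)
    (ip : {dot E for idfun}) : Prop :=
  forall x : E, `|x| ^+ 2 = ip x x.

(* [g] is the gradient of [f] at [x]; it is unique, as [f] is defined on all
   of [E]. *)
Definition has_gradient (R : realType) (E : normedModType R)
    (ip : {dot E for idfun}) (f : E -> R) (x g : E) : Prop :=
  (f (x + h) - f x - ip g h) / `|h| @[h --> (0 : E)^'] --> (0 : R).

(* Main.v *)
(** Restricted to a segment of [s], [f] becomes a function [phi] of one real
    variable whose derivative is [u |-> <gradf (y + u (x - y)), x - y>].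
    (1) => (2) lets [h] tend to [0+] in the difference quotients, which convexity
    bounds by [f y - f x]; (2) => (3) adds two instances of (2); for (3) => (1),
    monotonicity of the gradient makes [phi'] nondecreasing on [[0, 1]], and the
    mean value theorem on [[0, t]] and [[t, 1]] compares the two slopes.  As [f]
    is defined and differentiable in the full space, [phi] is differentiable also
    at the end points of the segment. *)
Require Import Defs.
From HB Require Import structures.
From mathcomp Require Import all_boot all_order all_algebra.
From mathcomp Require Import all_classical all_reals all_analysis.
From mathcomp Require Import lra ring.
Import Order.TTheory GRing.Theory Num.Theory.
Import numFieldNormedType.Exports.

Local Open Scope classical_set_scope.
Local Open Scope ring_scope.
Set Implicit Arguments.
Unset Strict Implicit.
Unset Printing Implicit Defensive.

(** For [h != 0], the quotient of [f] along [h *: d] differs from [ip g d] by [|q (h *: d)| * |d|]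
    in absolute value, where [q] is the quotient in [has_gradient]. *)
Lemma has_gradient_is_derive (R : realType) (E : normedModType R)
    (ip : {dot E for idfun}) (f : E -> R) (x g d : E) :
  has_gradient ip f x g -> is_derive x d f (ip g d).
Proof.
rewrite /has_gradient; set q := fun h : E => _ => gradx.
(* Here [0 / 0 = 0] is the wanted value: [q] becomes continuous at [0], so that
   the limit along [h *: d] is also [0] when [d = 0]. *)
have q0 : q 0 = 0 by rewrite /q addr0 linear0r !subrr mul0r.
have q_cont : {for 0, continuous q}.
  by apply/continuous_withinNx; rewrite q0.
have qd0 : q (h *: d) @[h --> (0 : R)^'] --> (0 : R).
  have := @continuous_comp _ _ _ (fun h : R => h *: d) q 0.
  rewrite scale0r => /(_ _ q_cont) qd.
  have /qd : {for 0, continuous (fun h : R => h *: d)}.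
    by apply: cvgZr_tmp; exact: cvg_id.
  by move=> /continuous_withinNx /=; rewrite scale0r q0.
suff dfx : h^-1 *: (f (h *: d + x) - f x) @[h --> (0 : R)^'] --> ip g d.
  split; first by apply/cvg_ex; exists (ip g d).
  exact: cvg_lim.
apply/subr_cvg0; apply/norm_cvg0P.
have qd : `|q (h *: d)| * `|d| @[h --> (0 : R)^'] --> (0 : R).
  have qd0' : `|q (h *: d)| @[h --> (0 : R)^'] --> (0 : R) by exact/norm_cvg0P.
  by have := cvgMr_tmp (b := `|d|) qd0'; rewrite mul0r; apply.
apply: cvg_trans qd.
apply: near_eq_cvg; near=> h.
have h0 : h != 0 by near: h; exact: nbhs_dnbhs_neq.
rewrite /q linearZr_LR /= normrM normfV normr_id normrZ.
(* The factor [|d|] can be cancelled only when [d != 0]. *)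
have [->|d0] := eqVneq d 0.
  by rewrite linear0r !scaler0 addr0 add0r subrr scaler0 normr0 mulr0 subr0 normr0.
rewrite [x + _]addrC.
have -> : h^-1 *: (f (h *: d + x) - f x) - ip g d =
    h^-1 * (f (h *: d + x) - f x - h * ip g d).
  by rewrite [RHS]mulrBr mulKf.
by rewrite normrM normfV invfM mulrA mulfVK ?normr_eq0// mulrC.
Unshelve. all: by end_near. Qed.

(** The difference quotient of [u |-> f (x + u *: d)] at [t] is that of [f] at [x + t *: d] in
    direction [d]. *)
Lemma has_gradient_is_derive_line (R : realType) (E : normedModType R)
    (ip : {dot E for idfun}) (f : E -> R) (x g d : E) (t : R) :
  has_gradient ip f (x + t *: d) g ->
  is_derive t 1 (fun u : R => f (x + u *: d)) (ip g d).
Proof.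
move=> /(has_gradient_is_derive d)[fd fdE].
have quotE : (fun h => h^-1 *: (f (x + (h *: (1 : R) + t) *: d) - f (x + t *: d)))
    = (fun h => h^-1 *: (f (h *: d + (x + t *: d)) - f (x + t *: d))).
  by apply/funext => h; rewrite /= [h *: 1]mulr1 scalerDl addrCA.
split; first by rewrite /derivable quotE.
by rewrite /derive quotE.
Qed.

Lemma convex_set_segment (R : numDomainType) (E : lmodType R) (s : set E)
    (x y : E) (t : R) :
  convex_set s -> s x -> s y -> 0 <= t <= 1 -> s (x + t *: (y - x)).
Proof.
move=> s_convex sx sy /andP[t0 t1].
have := s_convex y x (Itv01 t0 t1) (mem_set sy) (mem_set sx).
rewrite inE; congr (s _).
change (t *: y + (1 - t) *: x = x + t *: (y - x)).
by rewrite scalerBl scale1r scalerBr addrCA.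
Qed.

Lemma derive_nondecreasing_chord (R : realType) (phi dphi : R -> R) (t : R) :
  (forall u : R, 0 <= u <= 1 -> is_derive u 1 phi (dphi u)) ->
  (forall u v : R, 0 <= u -> u <= v -> v <= 1 -> dphi u <= dphi v) ->
  0 <= t <= 1 -> phi t <= t * phi 1 + (1 - t) * phi 0.
Proof.
move=> phiP dphi_mono /andP[t0 t1].
(* Allowing [a = b] covers [t = 0] and [t = 1] without a case split. *)
have mvt (a b : R) : 0 <= a -> a <= b -> b <= 1 ->
    exists2 c, c \in `[a, b]%R & phi b - phi a = dphi c * (b - a).
  move=> a0 ab b1.
  have phiP' c : c \in `[a, b]%R -> is_derive c 1 phi (dphi c).
    rewrite in_itv /= => /andP[ac cb]; apply: phiP.
    by rewrite (le_trans a0 ac) (le_trans cb b1).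
  have phi_cont : {within `[a, b], continuous phi}.
    by apply: derivable_within_continuous => c cab; have [] := phiP' c cab.
  have phi_derive c : c \in `]a, b[%R -> is_derive c 1 phi (dphi c).
    by move=> /subset_itv_oo_cc; exact: phiP'.
  exact: MVT_segment ab phi_derive phi_cont.
have [a] := mvt 0 t (lexx _) t0 t1.
have [b] := mvt t 1 t0 t1 (lexx _).
rewrite !in_itv /= => /andP[tb b1] phi1 /andP[a0 at_] phi0.
(* The mean value points satisfy [a <= t <= b]. *)
have dab := dphi_mono a b a0 (le_trans at_ tb) b1.
rewrite -subr_ge0.
have -> : t * phi 1 + (1 - t) * phi 0 - phi t =
    t * (phi 1 - phi t) - (1 - t) * (phi t - phi 0) by ring.
rewrite phi1 phi0.
have -> : t * (dphi b * (1 - t)) - (1 - t) * (dphi a * (t - 0)) =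
    t * (1 - t) * (dphi b - dphi a) by ring.
by rewrite !mulr_ge0 ?subr_ge0.
Qed.

Theorem theorem2 (R : realType) (E : completeNormedModType R)
    (ip : {dot E for idfun}) (ip_norm : induces_norm ip)
    (s : set E) (s_convex : convex_set s)
    (f : E -> R) (gradf : E -> E)
    (gradfP : forall x : E, s x -> has_gradient ip f x (gradf x)) :
  [<-> convex_function s f;
       forall x y : E, s x -> s y -> f y >= f x + ip (gradf x) (y - x);
       forall x y : E, s x -> s y -> ip (gradf x - gradf y) (x - y) >= 0].
Proof.
split; [|split] => /=.
- move=> f_convex x y sx sy; rewrite -lerBrDl.
  have [fd fdE] := has_gradient_is_derive (y - x) (gradfP x sx).
  have /cvg_dnbhs_at_right : h^-1 *: (f (h *: (y - x) + x) - f x)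
      @[h --> (0 : R)^'] --> ip (gradf x) (y - x).
    by rewrite -fdE; exact: fd.
  move=> /cvgr_to_le; apply.
  near=> h.
  have h0 : 0 < h by near: h; exact: nbhs_right_gt.
  have h1 : h <= 1 by near: h; exact: nbhs_right_le.
  (* The weight [h] is put on [y], so the combination is [x] moved by [h *: (y - x)]; dividing by
     [h > 0] bounds the quotient. *)
  have := f_convex (Itv01 (ltW h0) h1) y x (mem_set sy) (mem_set sx).
  change (f (h *: y + (1 - h) *: x) <= h * f y + (1 - h) * f x ->
    h^-1 * (f (h *: (y - x) + x) - f x) <= f y - f x).
  have -> : h *: y + (1 - h) *: x = h *: (y - x) + x.
    by rewrite scalerBl scale1r scalerBr addrAC -addrA.
  by rewrite ler_pdivrMl // => fh; lra.
- move=> f_ge x y sx sy.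
  have := lerD (f_ge x y sx sy) (f_ge y x sy sx).
  (* Once both instances are written with [x - y], the values of [f] cancel in the sum. *)
  rewrite -(opprB x y) linearNr linearBl.
  lra.
- move=> grad_mono t x y; rewrite !inE => sx sy.
  (* The segment runs from [y] at [0] to [x] at [1], matching the weight [t] on [x]. *)
  pose phi u := f (y + u *: (x - y)).
  pose dphi u := ip (gradf (y + u *: (x - y))) (x - y).
  have seg (u : R) : 0 <= u <= 1 -> s (y + u *: (x - y)).
    exact: convex_set_segment.
  have phiP (u : R) : 0 <= u <= 1 -> is_derive u 1 phi (dphi u).
    by move=> u01; apply: has_gradient_is_derive_line; exact/gradfP/seg.
  have dphi_mono (u v : R) : 0 <= u -> u <= v -> v <= 1 -> dphi u <= dphi v.
    move=> u0; rewrite le_eqVlt => /predU1P[-> //|uv] v1.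
    have su : s (y + u *: (x - y)) by apply: seg; rewrite u0 (le_trans (ltW uv)).
    have sv : s (y + v *: (x - y)).
      by apply: seg; rewrite v1 (le_trans u0 (ltW uv)).
    (* The two points differ by [(v - u) *: (x - y)]; the factor [v - u > 0] is divided out. *)
    have := grad_mono _ _ sv su.
    rewrite opprD addrACA subrr add0r -scalerBl linearZr_LR /=.
    by rewrite pmulr_rge0 ?subr_gt0// linearBl subr_ge0.
  change (f (t%:num *: x + (1 - t%:num) *: y)
    <= t%:num * f x + (1 - t%:num) * f y).
  have -> : f (t%:num *: x + (1 - t%:num) *: y) = phi t%:num.
    by rewrite /phi scalerBl scale1r scalerBr addrCA.
  have -> : f y = phi 0 by rewrite /phi scale0r addr0.
  have -> : f x = phi 1 by rewrite /phi scale1r addrC subrK.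
  apply: (derive_nondecreasing_chord phiP dphi_mono).
  by apply/andP; split.
Unshelve. all: by end_near. Qed.
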